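(* Let $d \ge 1$, let $A \subseteq \mathbb{R}^d$ be finite and generic, let $k \ge 0$ be an integer, and let $a \in A$. Then every $x \in \mathbb{R}^d$ that is generic with respect to $A$ is contained in at most $\binom{d+k}{d}$ $k$-hefty simplices of $A$, with equality if and only if $x \in \mathrm{Hull}_k(A)$. Moreover, there is $\varepsilon>0$ such that every $x$ generic with respect to $A$ with $\|x-a\|<\varepsilon$ is contained in at most $\binom{d+k-1}{d-1}$ $k$-hefty simplices of $A$ having $a$ as a vertex.
   Context: $A$ is generic if no $d+1$ of its points lie on a common affine hyperplane and no $d+2$ of its points lie on a common $(d-1)$-sphere. For generic $A$, any $d+1$ of its points span a $d$-simplex with a unique circumscribed $(d-1)$-sphere; a point is inside a sphere if it lies in the interior of the closed ball bounded by it. A $d$-simplex with vertices in $A$ is $k$-hefty if exactly $k$ points of $A$ lie inside its circumscribed sphere. A point $x$ is generic with respect to $A$ if $x \notin A$ and $A \cup \{x\}$ is generic. The $k$-hull $\mathrm{Hull}_k(A)$ is the intersection of all closed half-spaces of $\mathbb{R}^d$ that miss at most $k$ points of $A$.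
   Formalization: The equality criterion is stated only for sets A with at least d points; for smaller A it can fail (d = 3, k = 0, A two points, x their midpoint: x lies in the hull but there are no simplices). Both upper bounds are stated without restriction. *)

(* Defs.v *)
From HB Require Import structures.
From mathcomp Require Import all_boot all_order all_algebra.
From mathcomp Require Import finmap.
From mathcomp Require Import all_classical all_reals.
From mathcomp Require Import topology normedtype.
Set Implicit Arguments.
Unset Strict Implicit.
Unset Printing Implicit Defensive.
Import Order.TTheory GRing.Theory Num.Theory.
Import numFieldNormedType.Exports.

Local Open Scope ring_scope.
Local Open Scope classical_set_scope.
Local Open Scope fset_scope.

Section Definitions.
Variables (R : realType) (d : nat).
Local Notation point := 'rV[R]_d.
Implicit Types (x u c : point) (A S : {fset point}) (k : nat) (H : set point).

Definition dot x u : R := \sum_(i < d) x ord0 i * u ord0 i.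

(* The norm that the library puts on 'rV[R]_d is the sup norm, so the Euclidean
   norm is defined here. Both induce the topology of 'rV[R]_d. *)
Definition enorm x : R := Num.sqrt (dot x x).

Definition sphere c (r : R) : set point := [set y | enorm (y - c) = r].

Definition cball c (r : R) : set point := [set y | enorm (y - c) <= r].

Definition on_common_hyperplane S : Prop :=
  exists u (b : R), u != 0 /\ forall p, p \in S -> dot u p = b.

Definition circumsphere S c (r : R) : Prop :=
  0 < r /\ forall p, p \in S -> sphere c r p.

Definition on_common_sphere S : Prop :=
  exists c (r : R), circumsphere S c r.

Definition generic A : Prop :=
  (forall S, S `<=` A -> #|` S| = d.+1 -> ~ on_common_hyperplane S) /\
  (forall S, S `<=` A -> #|` S| = d.+2 -> ~ on_common_sphere S).

Definition generic_wrt A x : Prop := x \notin A /\ generic (x |` A).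

Definition affinely_independent S : Prop :=
  forall w : point -> R,
    \sum_(p <- S) w p = 0 -> \sum_(p <- S) w p *: p = 0 ->
    forall p, p \in S -> w p = 0.

(* A d-simplex is represented by the finite set of its d+1 vertices. *)
Definition simplex_of A S : Prop :=
  [/\ (S `<=` A)%fset, #|` S| = d.+1 & affinely_independent S].

Definition conv S : set point :=
  [set x | exists w : point -> R,
     [/\ forall p, p \in S -> 0 <= w p,
         \sum_(p <- S) w p = 1 & x = \sum_(p <- S) w p *: p]].

Definition points_inside A c (r : R) : {fset point} :=
  [fset p in A | `[< interior (cball c r) p >]].

(* The circumscribed sphere of a d-simplex exists and is unique, so the
   existential quantifier below speaks of that sphere. *)
Definition hefty A k S : Prop :=
  simplex_of A S /\
  exists c (r : R), circumsphere S c r /\ #|` points_inside A c r| = k.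

Definition hefty_simplices_containing A k x : {fset {fset point}} :=
  [fset S in fpowerset A | `[< hefty A k S /\ conv S x >]].

Definition closed_halfspace H : Prop :=
  exists u (b : R), u != 0 /\ H = [set y | dot u y <= b].

Definition hull A k : set point :=
  (\bigcap_(H in [set H | closed_halfspace H /\
     (#|` [fset p in A | p \notin H]| <= k)%N]) H)%classic.

End Definitions.

(* Main.v *)
(* Lift the points to the paraboloid. The k-hefty simplices containing x become
   the bases S of the linear program [min sum w_p z_p, sum w_p (1, p) = (1, x),
   w >= 0] that have exactly k lifted points below the hyperplane spanned by S.
   Every vertex set Q whose hull contains x has exactly one optimal basis, so the
   sums over S of the binomials C(#above S, j) count such sets Q and do not depend
   on the heights z; hence neither does h_k, the number of bases with k points
   below. Lifting a point i very high gives h_k(A \ i) <= h_k(A), and double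
   counting gives McMullen's recurrence
     sum_i h_k(A \ i) + (d + 1 + k) h_k = (k + 1) h_(k+1) + |A| h_k.
   Therefore (k + 1) h_(k+1) <= (d + 1 + k) h_k and h_k <= C(d + k, k), with
   equality iff x lies in the hull of A minus any k points; Farkas' lemma
   identifies this with the k-hull. For the simplices with vertex a the same
   count is applied to the vectors p - a with heights |p - a|^2, in one dimension
   less. *)
Require Import Defs.
From mathcomp Require Import all_boot all_order all_algebra.
From mathcomp Require Import finmap.
From mathcomp Require Import all_classical all_reals.
From mathcomp Require Import topology normedtype.
From mathcomp Require Import ring lra zify.
Set Implicit Arguments.
Unset Strict Implicit.
Unset Printing Implicit Defensive.
Import Order.TTheory GRing.Theory Num.Theory.
Import numFieldNormedType.Exports.

Local Open Scope ring_scope.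

(** * Bilinearity and definiteness of the dot product *)

Section Dot.
Variables (R : realType) (d : nat).
Implicit Types (x u c p : 'rV[R]_d) (b r : R).

Lemma dotC x u : dot x u = dot u x.
Proof. by apply: eq_bigr => i _; rewrite mulrC. Qed.

Lemma dotDl x u c : dot (x + u) c = dot x c + dot u c.
Proof. by rewrite -big_split; apply: eq_bigr => i _; rewrite mxE mulrDl. Qed.

Lemma dotDr x u c : dot c (x + u) = dot c x + dot c u.
Proof. by rewrite !(dotC c) dotDl. Qed.

Lemma dotZl b x u : dot (b *: x) u = b * dot x u.
Proof. by rewrite /dot mulr_sumr; apply: eq_bigr => i _; rewrite mxE mulrA. Qed.

Lemma dotZr b x u : dot u (b *: x) = b * dot u x.
Proof. by rewrite !(dotC u) dotZl. Qed.

Lemma dotNl x u : dot (- x) u = - dot x u.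
Proof. by rewrite -scaleN1r dotZl mulN1r. Qed.

Lemma dotNr x u : dot u (- x) = - dot u x.
Proof. by rewrite !(dotC u) dotNl. Qed.

Lemma dot0l u : dot 0 u = 0 :> R.
Proof. by rewrite -[0](scale0r u) dotZl mul0r. Qed.

Lemma dot_suml (I : Type) (s : seq I) (P : pred I) (f : I -> 'rV[R]_d) u :
  dot (\sum_(i <- s | P i) f i) u = \sum_(i <- s | P i) dot (f i) u.
Proof.
elim/big_rec2: _ => [|i a b _ <-]; [exact: dot0l | exact: dotDl].
Qed.

Lemma dot_sumr (I : Type) (s : seq I) (P : pred I) (f : I -> 'rV[R]_d) u :
  dot u (\sum_(i <- s | P i) f i) = \sum_(i <- s | P i) dot u (f i).
Proof. by rewrite dotC dot_suml; apply: eq_bigr => i _; rewrite dotC. Qed.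

Lemma dotxx_ge0 x : 0 <= dot x x.
Proof. by apply: sumr_ge0 => i _; rewrite -expr2 sqr_ge0. Qed.

Lemma dotxx_eq0 x : (dot x x == 0) = (x == 0).
Proof.
apply/eqP/eqP => [x0|->]; last exact: dot0l.
apply/rowP => i; rewrite mxE; apply/eqP; rewrite -sqrf_eq0 expr2; apply/eqP.
by apply: (psumr_eq0P _ x0) => // j _; rewrite -expr2 sqr_ge0.
Qed.

Lemma dotxx_gt0 x : (0 < dot x x) = (x != 0).
Proof. by rewrite lt_neqAle dotxx_ge0 andbT eq_sym dotxx_eq0. Qed.

End Dot.

Lemma dot_row_mx (R : realType) (d : nat) (a b : R) (p q : 'rV[R]_d) :
  dot (row_mx a%:M p : 'rV_(1 + d)) (row_mx b%:M q) = a * b + dot p q.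
Proof.
rewrite /dot big_split_ord /= big_ord1 !row_mxEl !mxE !eqxx !mulr1n.
by congr (_ + _); apply: eq_bigr => i _; rewrite !row_mxEr.
Qed.

(** * Distributions determined by their binomial moments *)

Section CountFromBinomials.
Variables (I : finType) (X : {set I}).
Implicit Types (a b : I -> nat).

Lemma sum_by_value a (f : nat -> nat) N : (forall i, a i <= N)%N ->
  (\sum_(i in X) f (a i) =
   \sum_(l < N.+1) #|[set i in X | a i == l]| * f l)%N.
Proof.
move=> aN; rewrite (partition_big (fun i => inord (a i) : 'I_N.+1) xpredT) //=.
apply: eq_bigr => l _; rewrite -sum_nat_const; apply: eq_big => [i|i].
  by rewrite inE -val_eqE /= inordK // ltnS.
by case/andP => _ /eqP <-; rewrite inordK // ltnS.
Qed.

(* The binomial sums determine the value counts by a triangular system, solved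
   from the largest value down. *)
Lemma count_from_binomials a b :
  (forall j, \sum_(i in X) 'C(a i, j) = \sum_(i in X) 'C(b i, j))%N ->
  forall k, #|[set i in X | a i == k]| = #|[set i in X | b i == k]|.
Proof.
move=> ab k; pose N := (\sum_i a i + \sum_i b i)%N.
have aN i : (a i <= N)%N by rewrite /N (bigD1 i) //= -!addnA leq_addr.
have bN i : (b i <= N)%N by rewrite /N [X in (_ + X)%N](bigD1 i) //= addnCA leq_addr.
(* Induction on [n] descends in [k]: the values beyond [N], which are never taken, are the base
   case. *)
have [n] : exists n, (N < k + n)%N by exists N.+1; rewrite addnS ltnS leq_addl.
have empty k' : (N < k')%N -> #|[set i in X | a i == k']| = #|[set i in X | b i == k']|.
  move=> Nk'; rewrite !eq_card0 // => i; rewrite !inE; apply/negP => /andP[_ /eqP E].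
    by move: (bN i); rewrite E leqNgt Nk'.
  by move: (aN i); rewrite E leqNgt Nk'.
elim: n k => [|n IHn] k; rewrite ?addn0 => Nk; first exact: empty.
have [kN|/empty//] := leqP k N.
have := ab k; rewrite (sum_by_value (fun l => 'C(l, k)) aN) (sum_by_value (fun l =>
  'C(l, k)) bN).
rewrite (bigD1 (Ordinal (kN : k < N.+1)%N)) // [X in _ = X -> _](bigD1 (Ordinal (kN
  : k < N.+1)%N)) //=.
rewrite binn !muln1 => /eqP; rewrite (eq_bigr (fun l : 'I_N.+1 => #|[set i in X | b
  i == l]| * 'C(l, k))%N).
  by rewrite eqn_add2r => /eqP.
move=> l; rewrite -val_eqE /= neq_ltn => /orP[lk|kl].
  by rewrite bin_small // !muln0.
by rewrite IHn //; move: Nk kl; rewrite addnS; lia.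
Qed.

End CountFromBinomials.

(** * Farkas' lemma *)

Section Farkas.
Variables (R : realType) (m : nat) (T : finType).
Implicit Types (B : {set T}) (v : T -> 'rV[R]_m).

(** Induction on [#|B|]. If the form [u] that separates [y] from [B :\ j] is positive at [v j], all
    vectors are projected along [v j] onto the kernel of [u], and the induction hypothesis is
    applied to the projections. *)
Lemma farkas B v (y : 'rV[R]_m) :
  (exists w : T -> R, (forall p, p \in B -> 0 <= w p) /\
     y = \sum_(p in B) w p *: v p) \/
  (exists u, (forall p, p \in B -> dot u (v p) <= 0) /\ 0 < dot u y).
Proof.
elim: {B}#|B| {-2}B (erefl #|B|) v y => [|n IHn] B cB v y.
  have B0 p : p \in B = false by rewrite (cards0_eq cB) inE.
  have [->|y0] := eqVneq y 0.
    left; exists (fun=> 0); split=> [p|]; first by rewrite B0.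
    by rewrite big_pred0.
  by right; exists y; split=> [p|]; rewrite ?B0 ?dotxx_gt0.
have /card_gt0P[j jB] : (0 < #|B|)%N by rewrite cB.
have cB' : #|B :\ j| = n by move: (cardsD1 j B); rewrite jB cB; lia.
have [[w [w0 yE]]|[u [u0 uy]]] := IHn _ cB' v y.
  left; exists (fun p => if p == j then 0 else w p); split=> [p pB|].
    by case: eqP => // /eqP pj; rewrite w0 // !inE pj.
  rewrite (big_setD1 j) //= eqxx scale0r add0r yE.
  by apply: eq_bigr => p; rewrite !inE => /andP[/negPf->].
have [uj|uj] := leP (dot u (v j)) 0.
  right; exists u; split=> // p pB.
  by have [->//|pj] := eqVneq p j; rewrite u0 // !inE pj.
pose a p := dot u p / dot u (v j).
have [[w [w0 yE]]|[u' [u'0 u'y]]] :=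
    IHn _ cB' (fun p => v p - a (v p) *: v j) (y - a y *: v j).
  (* The weight of [j] undoes the projections; it is nonnegative because [a y > 0] and
     [a (v p) <= 0] on [B :\ j]. *)
  left; exists (fun p => if p == j then a y - \sum_(p in B :\ j) w p * a (v p)
                         else w p); split=> [p pB|].
    case: eqP => [_|/eqP pj]; last by rewrite w0 // !inE pj.
    rewrite subr_ge0; apply: (@le_trans _ _ 0); last by rewrite divr_ge0 ?ltW.
    rewrite -oppr_ge0 -sumrN; apply: sumr_ge0 => q qB.
    by rewrite -mulrN mulr_ge0 ?w0 // oppr_ge0 /a pmulr_lle0 ?u0 // invr_gt0.
  rewrite (big_setD1 j) //= eqxx.
  rewrite (eq_bigr (fun p => w p *: v p)); last first.
    by move=> p; rewrite !inE => /andP[/negPf->].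
  move/eqP: yE; rewrite subr_eq => /eqP yE; rewrite [LHS]yE.
  rewrite (eq_bigr (fun p => w p *: v p - (w p * a (v p)) *: v j)); last first.
    by move=> p _; rewrite scalerBr scalerA.
  by rewrite sumrB -scaler_suml scalerBl addrC addrA [RHS]addrAC.
(* This is [u'] composed with the projection, so it vanishes at [v j]. *)
right; exists (u' - (dot u' (v j) / dot u (v j)) *: u).
have E p : dot (u' - (dot u' (v j) / dot u (v j)) *: u) p =
    dot u' (p - a p *: v j).
  by rewrite !(dotDl, dotDr, dotNl, dotNr, dotZl, dotZr) /a; field; rewrite gt_eqF.
rewrite E; split=> // p pB; rewrite E.
have [->|pj] := eqVneq p j; last by rewrite u'0 // !inE pj.
by rewrite /a divff ?gt_eqF // scale1r subrr dotC dot0l.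
Qed.
End Farkas.

(** * Lifted vectors and feasible bases of a linear program *)

Section Cone.
Variables (R : realType) (m : nat) (T : finType) (v : T -> 'rV[R]_m.+1).
Variable y : 'rV[R]_m.+1.
Implicit Types (B Q S : {set T}) (w l z : T -> R) (u : 'rV[R]_m.+1).

Definition cone Q : bool :=
  `[< exists w, (forall p, p \in Q -> 0 <= w p) /\
        y = \sum_(p in Q) w p *: v p >].

(* The linear form whose graph contains the lifted points [(v p, z p)], [p] in
   [S]; it is the junk value [0] if there is no such form. *)
Definition interp z S : 'rV[R]_m.+1 :=
  xget 0 [set u | forall p, p \in S -> dot u (v p) = z p]%classic.

Definition below z S : {set T} := [set i | z i < dot (interp z S) (v i)].
Definition above z S : {set T} := [set i | dot (interp z S) (v i) < z i].

(* Positivity of the heights bounds the linear program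
   [min (sum w z), sum w v = y, w >= 0] from below. *)
Definition generic_lift z : Prop :=
  (forall i, 0 < z i) /\
  (forall S i, #|S| = m.+1 -> i \notin S -> dot (interp z S) (v i) != z i).

(** The cardinality alone makes [S] a linear basis, since [v_gen] below makes any [m.+1] of the
    vectors independent. *)
Definition bases B : {set {set T}} :=
  [set S : {set T} | [&& S \subset B, #|S| == m.+1 & cone S]].

Definition bases_below z B (k : nat) : {set {set T}} :=
  [set S in bases B | #|B :&: below z S| == k].

Lemma cone_sub Q Q' : Q \subset Q' -> cone Q -> cone Q'.
Proof.
move=> QQ' /asboolP[w [w0 yE]]; apply/asboolP.
exists (fun p => if p \in Q then w p else 0); split=> [p _|].
  by case: ifP => // /w0.
rewrite yE [RHS](bigID (mem Q)) /= [X in _ + X]big1 ?addr0; last first.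
  by move=> p /andP[_ /negPf->]; rewrite scale0r.
apply: eq_big => [p|p ->//].
by rewrite andbC; case: (boolP (p \in Q)) => // /(fintype.subsetP QQ')->.
Qed.

(** * Interpolation and coordinates for vectors in general position *)

Hypothesis v_gen : forall S, #|S| = m.+1 ->
  forall u, (forall p, p \in S -> dot u (v p) = 0) -> u = 0.
Hypothesis y_gen : forall S, #|S| = m ->
  forall u, (forall p, p \in S -> dot u (v p) = 0) -> dot u y = 0 -> u = 0.

(** The interpolation conditions form a square linear system, whose matrix is invertible because
    [v_gen] makes its kernel trivial. *)
Lemma interpE z S p : #|S| = m.+1 -> p \in S -> dot (interp z S) (v p) = z p.
Proof.
move=> cS pS.
suff [u uP] : exists u, forall p, p \in S -> dot u (v p) = z p.
  by apply: (@xgetPex _ 0 [set u | forall p, p \in S -> dot u (v p) = z p]%classic)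
    pS; exists u.
pose f (i : 'I_m.+1) := enum_val (cast_ord (esym cS) i) : T.
pose M := \matrix_(i < m.+1) v (f i).
have ME u i : (u *m M^T) 0 i = dot u (v (f i)).
  by rewrite mxE; apply: eq_bigr => j _; rewrite !mxE.
have fS q : q \in S -> exists i, q = f i.
  move=> qS; exists (cast_ord cS (enum_rank_in qS q)).
  by rewrite /f cast_ordK enum_rankK_in.
have uM : M^T \in unitmx.
  rewrite -row_free_unit; apply: inj_row_free => u u0; apply: (v_gen cS).
  by move=> q /fS[i ->]; rewrite -ME u0 mxE.
exists ((\row_i z (f i)) *m invmx M^T) => q /fS[i ->].
by rewrite -ME mulmxKV // mxE.
Qed.

Lemma interp_unique z S u : #|S| = m.+1 ->
  (forall p, p \in S -> dot u (v p) = z p) -> u = interp z S.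
Proof.
move=> cS uP; apply/eqP; rewrite -subr_eq0; apply/eqP; apply: (v_gen cS).
by move=> p pS; rewrite dotDl dotNl uP // interpE // subrr.
Qed.

(** The interpolant of the indicator of [p] is the dual basis vector at [p], so this is the
    coefficient of [v p] in the expansion of [x] over [S]. *)
Definition bary_coord S p x := dot (interp (fun q => (q == p)%:R) S) x.

Lemma coord_comb S l p : #|S| = m.+1 -> p \in S ->
  bary_coord S p (\sum_(q in S) l q *: v q) = l p.
Proof.
move=> cS pS; rewrite /bary_coord dot_sumr (bigD1 p) //= dotZr interpE // eqxx mulr1.
rewrite big1 ?addr0 // => q /andP[qS /negPf qp].
by rewrite dotZr interpE // qp mulr0.
Qed.

(** Every dual basis form vanishes at the error [D] of the expansion. As [D] is itself a combination
    of these forms, [dot D D = 0]. *)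
Lemma coord_sum S x : #|S| = m.+1 -> \sum_(p in S) bary_coord S p x *: v p = x.
Proof.
move=> cS; apply/eqP; rewrite -subr_eq0; set D := _ - _.
rewrite -dotxx_eq0.
have DE : D = \sum_(p in S) dot D (v p) *: interp (fun q => (q == p)%:R) S.
  rewrite [LHS](interp_unique (z := fun p => dot D (v p)) cS) //.
  apply/esym/interp_unique => // p pS.
  rewrite dot_suml (bigD1 p) //= dotZl interpE // eqxx mulr1.
  rewrite big1 ?addr0 // => q /andP[qS /negPf qp].
  by rewrite dotZl interpE // eq_sym qp mulr0.
rewrite {1}DE dot_suml big1 // => p pS; rewrite dotZl {2}/D dotDr dotNr.
by rewrite -/(bary_coord S p _) -/(bary_coord S p _) coord_comb // subrr mulr0.
Qed.

(** Otherwise the dual form at [p] would vanish on [S :\ p] and at [y], hence be zero by [y_gen],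
    although it is [1] at [v p]. *)
Lemma coord_y_neq0 S p : #|S| = m.+1 -> p \in S -> bary_coord S p y != 0.
Proof.
move=> cS pS; apply/eqP => y0.
have /y_gen : #|S :\ p| = m by move: (cardsD1 p S); rewrite pS cS; lia.
move/(_ (interp (fun q => (q == p)%:R) S)) => H.
have u0 : interp (fun q => (q == p)%:R) S = 0.
  apply: H => // q; rewrite !inE => /andP[/negPf qp qS].
  by rewrite interpE // qp.
have := interpE (fun q => (q == p)%:R) cS pS.
by rewrite u0 dot0l eqxx => /eqP; rewrite eq_sym oner_eq0.
Qed.

Lemma coord_v_neq0 S p j : #|S| = m.+1 -> p \in S -> j \notin S ->
  bary_coord S p (v j) != 0.
Proof.
move=> cS pS jS; apply/eqP => y0.
have /v_gen : #|j |: (S :\ p)| = m.+1.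
  by rewrite cardsU1 !inE (negPf jS) andbF; move: (cardsD1 p S); rewrite pS cS; lia.
move/(_ (interp (fun q => (q == p)%:R) S)) => H.
have u0 : interp (fun q => (q == p)%:R) S = 0.
  apply: H => // q; rewrite !inE => /orP[/eqP->//|/andP[/negPf qp qS]].
  by rewrite interpE // qp.
have := interpE (fun q => (q == p)%:R) cS pS.
by rewrite u0 dot0l eqxx => /eqP; rewrite eq_sym oner_eq0.
Qed.

(** * Pivoting and optimal bases *)

Lemma basis_coord_gt0 S p : #|S| = m.+1 -> cone S -> p \in S ->
  0 < bary_coord S p y.
Proof.
move=> cS /asboolP[w [w0 yE]] pS; rewrite lt_neqAle eq_sym coord_y_neq0 //=.
by rewrite yE coord_comb // w0.
Qed.

Lemma dot_y_comb S u : #|S| = m.+1 ->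
  dot u y = \sum_(p in S) bary_coord S p y * dot u (v p).
Proof.
move=> cS; rewrite -{1}(coord_sum y cS) dot_sumr.
by apply: eq_bigr => p _; rewrite dotZr.
Qed.

(* The ratio test of the simplex method: a nonnegative representation of [y] is
   moved along a linear relation until the weight of some [p] vanishes. *)
Lemma ratio_test Q w l z :
  (forall p, p \in Q -> 0 <= w p) -> y = \sum_(p in Q) w p *: v p ->
  \sum_(p in Q) l p *: v p = 0 -> (exists2 p, p \in Q & 0 < l p) ->
  exists p w', [/\ p \in Q /\ 0 < l p,
    forall q, q \in Q :\ p -> 0 <= w' q, y = \sum_(q in Q :\ p) w' q *: v q &
    \sum_(q in Q :\ p) w' q * z q =
      \sum_(q in Q) w q * z q - w p / l p * \sum_(q in Q) l q * z q].
Proof.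
move=> w0 yE l0 [p0 p0Q lp0].
have P0 : (p0 \in Q) && (0 < l p0) by rewrite p0Q.
case: (@arg_minP _ _ _ p0 (fun p => (p \in Q) && (0 < l p)) (fun p => w p / l p)
  P0) => p /andP[pQ lp] pmin.
exists p, (fun q => w q - w p / l p * l q); split=> [//|q||].
- rewrite !inE => /andP[_ qQ]; rewrite subr_ge0.
  have [lq|lq] := ltP 0 (l q); first by rewrite -ler_pdivlMr ?pmin ?qQ.
  by apply: (le_trans _ (w0 q qQ)); rewrite mulr_ge0_le0 // divr_ge0 ?w0 // ltW.
- have -> : y = \sum_(q in Q) (w q - w p / l p * l q) *: v q.
    under eq_bigr do rewrite scalerBl -scalerA.
    by rewrite sumrB -scaler_sumr l0 scaler0 subr0.
  by rewrite (big_setD1 p) //= divfK ?gt_eqF // subrr scale0r add0r.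
- rewrite mulr_sumr -sumrB [RHS](big_setD1 p) //= mulrA divfK ?gt_eqF //.
  by rewrite subrr add0r; apply: eq_bigr => q _; rewrite mulrBl mulrA.
Qed.

(** This makes the ratio test applicable: with positive heights, a nonzero [l] without positive
    entries would have negative cost. *)
Lemma exists_pos_weight Q l z : (forall i, 0 < z i) ->
  0 <= \sum_(p in Q) l p * z p -> (exists2 p, p \in Q & l p != 0) ->
  exists2 p, p \in Q & 0 < l p.
Proof.
move=> z0 s0 [p pQ lp]; apply: contrapT => npos.
have l0 q : q \in Q -> l q <= 0.
  by move=> qQ; rewrite leNgt; apply/negP => ?; apply: npos; exists q.
have N0 q : q \in Q -> 0 <= - (l q * z q).
  by move=> /l0 lq; rewrite -mulNr mulr_ge0 ?oppr_ge0 // ltW.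
have sE : \sum_(p in Q) - (l p * z p) = 0.
  by apply/le_anti; rewrite sumr_ge0 // sumrN oppr_le0 s0.
have /eqP := psumr_eq0P N0 sE pQ.
by rewrite oppr_eq0 mulf_eq0 (negPf lp) gt_eqF.
Qed.

Lemma exists_relation Q : (m.+1 < #|Q|)%N ->
  exists2 l, \sum_(p in Q) l p *: v p = 0 & exists2 p, p \in Q & l p != 0.
Proof.
move=> cQ; have [S SQ cS] : exists2 S : {set T}, S \subset Q & #|S| = m.+1.
  have : (0 < #|[set A : {set T} | A \subset Q & #|A| == m.+1]|)%N.
    by rewrite cards_draws bin_gt0 ltnW.
  by case/card_gt0P => S; rewrite inE => /andP[SQ /eqP]; exists S.
have /card_gt0P[j] : (0 < #|Q :\: S|)%N.
  by rewrite cardsD (finset.setIidPr SQ) cS subn_gt0.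
rewrite inE => /andP[jS jQ].
exists (fun p => if p \in S then bary_coord S p (v j) else - (p == j)%:R).
  rewrite (big_setID S) /= (finset.setIidPr SQ).
  rewrite (eq_bigr (fun p => bary_coord S p (v j) *: v p)); last by move=> p ->.
  rewrite coord_sum // (big_setD1 j) ?inE ?jS //= (negPf jS) eqxx scaleN1r.
  rewrite big1 ?addr0 ?subrr // => p; rewrite !inE => /and3P[/negPf-> /negPf-> _].
  by rewrite oppr0 scale0r.
by exists j; rewrite // (negPf jS) eqxx oppr_eq0 oner_eq0.
Qed.

(** Caratheodory's argument with a cost: while more than [m.+1] vectors remain, the ratio test along
    a relation of nonnegative cost removes one of them without raising the cost. *)
Lemma exists_basis_le Q w z : (forall i, 0 < z i) -> (m < #|Q|)%N ->
  (forall p, p \in Q -> 0 <= w p) -> y = \sum_(p in Q) w p *: v p ->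
  exists2 S, S \in bases Q & dot (interp z S) y <= \sum_(p in Q) w p * z p.
Proof.
move=> z0; elim: {Q}#|Q| {-2}Q w (erefl #|Q|) => [|n IHn] Q w cQ; rewrite ?cQ //.
rewrite ltnS leq_eqVlt => /orP[/eqP mn|mn] w0 yE.
  exists Q; first by rewrite inE subxx cQ mn eqxx; apply/asboolP; exists w.
  rewrite {1}yE dot_sumr; apply: ler_sum => p pQ.
  by rewrite dotZr interpE // cQ mn.
have [|l l0 lnz] := @exists_relation Q; first by rewrite cQ.
wlog ls : l l0 lnz / 0 <= \sum_(p in Q) l p * z p.
  move=> H; have [/H|ls] := leP 0 (\sum_(p in Q) l p * z p); first exact.
  apply: (H (fun p => - l p)).
  - by under eq_bigr do rewrite scaleNr; rewrite sumrN l0 oppr0.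
  - by case: lnz => p pQ lp; exists p; rewrite // oppr_eq0.
  - by under eq_bigr do rewrite mulNr; rewrite sumrN oppr_ge0 ltW.
have lpos := exists_pos_weight z0 ls lnz.
have [p [w' [[pQ lp] w'0 yE' sE]]] := ratio_test z w0 yE l0 lpos.
have cQp : #|Q :\ p| = n by move: (cardsD1 p Q); rewrite pQ cQ; lia.
have [|S] := IHn _ w' cQp _ w'0 yE'; first by rewrite cQp.
rewrite !inE => /and3P[SQ cS coneS] le; exists S.
  by rewrite !inE cS coneS (fintype.subset_trans SQ) ?subD1set.
apply: (le_trans le); rewrite sE gerBl mulr_ge0 // divr_ge0 ?w0 // ltW //.
Qed.

(** A basis of least cost works: if some [j] in [Q :\: S] were below the interpolant, pivoting [j]
    into [S] would give a strictly cheaper basis. *)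
Lemma exists_min_basis Q z : generic_lift z -> (m < #|Q|)%N -> cone Q ->
  exists2 S, S \in bases Q & Q :\: S \subset above z S.
Proof.
move=> [z0 zgen] cQ /asboolP[w [w0 yE]].
have [S0 S0Q _] := exists_basis_le z0 cQ w0 yE.
case: (@arg_minP _ _ _ S0 (fun S => S \in bases Q) (fun S => dot (interp z S) y) S0Q).
move=> S SQ Smin; exists S => //; apply/fintype.subsetP => j.
move: (SQ); rewrite !inE => /and3P[sSQ /eqP cS coneS] /andP[jS jQ].
rewrite lt_neqAle zgen //= leNgt; apply/negP => jbelow.
(* Subtracting multiples of the relation [l] from the representation [w1] of [y] over [S] gives [j]
   positive weight; since [l j = -1], the vector that leaves is in [S], where [w1] is positive, so
   the cost drops strictly. *)
pose l p := if p == j then - 1 else bary_coord S p (v j).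
pose w1 p := if p == j then 0 else bary_coord S p y.
have l_S p : p \in S -> l p = bary_coord S p (v j).
  by move=> pS; rewrite /l; case: eqP pS jS => // -> ->.
have w1_S p : p \in S -> w1 p = bary_coord S p y.
  by move=> pS; rewrite /w1; case: eqP pS jS => // -> ->.
have w10 p : p \in j |: S -> 0 <= w1 p.
  rewrite !inE => /orP[/eqP->|pS]; first by rewrite /w1 eqxx.
  by rewrite w1_S // ltW // basis_coord_gt0.
have y1E : y = \sum_(p in j |: S) w1 p *: v p.
  rewrite big_setU1 //= {1}/w1 eqxx scale0r add0r -[LHS](coord_sum y cS).
  by apply: eq_bigr => p pS; rewrite w1_S.
have l0 : \sum_(p in j |: S) l p *: v p = 0.
  rewrite big_setU1 //= {1}/l eqxx scaleN1r (eq_bigr (fun p => bary_coord S p (v j)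
    *: v p)).
    by rewrite coord_sum // addNr.
  by move=> p pS; rewrite l_S.
have lz : 0 < \sum_(p in j |: S) l p * z p.
  rewrite big_setU1 //= {1}/l eqxx mulN1r addrC subr_gt0.
  rewrite (eq_bigr (fun p => dot (interp z S) (bary_coord S p (v j) *: v p))).
    by rewrite -dot_sumr coord_sum.
  by move=> p pS; rewrite l_S // dotZr interpE.
have lpos : exists2 p, p \in j |: S & 0 < l p.
  apply: (exists_pos_weight z0 (ltW lz)); exists j; first by rewrite setU11.
  by rewrite /l eqxx oppr_eq0 oner_eq0.
have [p [w' [[pjS lp] w'0 yE' sE]]] := ratio_test z w10 y1E l0 lpos.
have pS : p \in S.
  move: pjS; rewrite !inE => /orP[/eqP pj|//].
  by move: lp; rewrite /l pj eqxx oppr_gt0 ltNge ler01.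
have c' : (m < #|(j |: S) :\ p|)%N.
  by move: (cardsD1 p (j |: S)); rewrite pjS cardsU1 jS cS; lia.
have [S' S'Q le] := exists_basis_le z0 c' w'0 yE'.
have S'bQ : S' \in bases Q.
  move: S'Q; rewrite !inE => /and3P[S'Q -> ->]; rewrite !andbT.
  apply: (fintype.subset_trans S'Q); apply: (fintype.subset_trans (subD1set _ _)).
  by rewrite finset.subUset finset.sub1set jQ.
have := Smin _ S'bQ; rewrite leNgt => /negP; apply; apply: (le_lt_trans le).
rewrite sE big_setU1 //= {1}/w1 eqxx mul0r add0r.
rewrite (eq_bigr (fun p => bary_coord S p y * dot (interp z S) (v p))); last first.
  by move=> q qS; rewrite w1_S // interpE.
rewrite -dot_y_comb // gtrBl mulr_gt0 // divr_gt0 //.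
by rewrite w1_S // basis_coord_gt0.
Qed.

(** Linear programming duality: [interp z S] stays below the heights on [Q], strictly off [S].
    Expanding [y] over [S'] with positive coordinates makes its value at [y] smaller than that of
    [interp z S'] as soon as [S'] leaves [S]. *)
Lemma min_basis_sub Q z S S' : generic_lift z ->
  S \in bases Q -> S' \in bases Q ->
  Q :\: S \subset above z S -> dot (interp z S') y <= dot (interp z S) y ->
  S' = S.
Proof.
move=> [z0 zgen]; rewrite !inE => /and3P[SQ /eqP cS coneS] /and3P[S'Q /eqP cS' coneS'].
move=> abv le; apply/eqP; rewrite eqEcard cS cS' leqnn andbT.
apply/fintype.subsetP => p pS'; apply: contraT => pS; move: le; rewrite leNgt =>
  /negP[].
have habv q : q \in S' -> q \notin S -> dot (interp z S) (v q) < z q.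
  move=> qS' qS; have := fintype.subsetP abv q; rewrite !inE qS.
  by rewrite (fintype.subsetP S'Q) //; apply.
rewrite !(dot_y_comb _ cS') [ltLHS](big_setD1 p) // [ltRHS](big_setD1 p) //=.
apply: ltr_leD.
  by rewrite ltr_pM2l ?basis_coord_gt0 // (interpE _ cS') // habv.
apply: ler_sum => q; rewrite inE => /andP[_ qS'].
rewrite ler_pM2l ?basis_coord_gt0 // (interpE _ cS') //.
by have [qS|qS] := boolP (q \in S); [rewrite interpE | rewrite ltW ?habv].
Qed.

Lemma min_basis_unique Q z S S' : generic_lift z ->
  S \in bases Q -> S' \in bases Q ->
  Q :\: S \subset above z S -> Q :\: S' \subset above z S' -> S = S'.
Proof.
move=> zgen SQ S'Q abv abv'.
have [le|/ltW le] := leP (dot (interp z S') y) (dot (interp z S) y).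
  by rewrite (min_basis_sub zgen SQ S'Q abv le).
by rewrite (min_basis_sub zgen S'Q SQ abv' le).
Qed.

(** * Vectors above and below a basis, and the count of faces *)

Lemma above_notin z S i : #|S| = m.+1 -> i \in above z S -> i \notin S.
Proof.
move=> cS; rewrite inE => lt; apply/negP => iS.
by rewrite interpE // ltxx in lt.
Qed.

Lemma below_notin z S i : #|S| = m.+1 -> i \in below z S -> i \notin S.
Proof.
move=> cS; rewrite inE => lt; apply/negP => iS.
by rewrite interpE // ltxx in lt.
Qed.

Lemma in_above z S i : generic_lift z -> #|S| = m.+1 ->
  (i \in above z S) = (i \notin S) && (i \notin below z S).
Proof.
move=> [_ zgen] cS; have [iS|iS] := boolP (i \in S).
  by apply/negP => /(above_notin cS); rewrite iS.
by rewrite !inE /= -leNgt lt_neqAle zgen.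
Qed.

Lemma card_below_above z B S : generic_lift z -> S \in bases B ->
  (#|B :&: below z S| + #|B :&: above z S| + m.+1 = #|B|)%N.
Proof.
move=> zgen; rewrite inE => /and3P[SB /eqP cS _].
rewrite -(cardsID S B) (finset.setIidPr SB) cS addnC; congr (_ + _)%N.
rewrite -(cardsID (below z S) (B :\: S)); congr (_ + _)%N; apply: eq_card => i.
  rewrite !finset.in_setI finset.in_setD.
  by case: (boolP (i \in below z S)) => [/(below_notin cS)->//|]; rewrite ?andbF.
rewrite finset.in_setI !finset.in_setD in_above //.
by case: (i \in S); case: (i \in B); case: (i \in below z S).
Qed.

(** In general position each such [Q] is the support of a [j]-dimensional face of the polyhedron of
    weights [w >= 0] on [B] that represent [y]; the case [j = 0] gives the bases as vertices. *)
Definition faces B j : {set {set T}} :=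
  [set Q : {set T} | [&& Q \subset B, #|Q| == (m.+1 + j)%N & cone Q]].

(** Such a [Q] is [S] together with any [j] vectors of [B] above it; its cone contains [y] because
    that of [S] does. *)
Lemma card_min_extensions z B S j : S \in bases B ->
  #|[set Q in faces B j | (S \subset Q) && (Q :\: S \subset above z S)]| =
  'C(#|B :&: above z S|, j).
Proof.
rewrite inE => /and3P[SB /eqP cS coneS]; rewrite -cards_draws.
rewrite -(card_in_imset (f := fun X => S :|: X)); last first.
  have sub X : X \in [set A : {set T} | A \subset B :&: above z S & #|A| == j] ->
      X = (S :|: X) :\: S.
    rewrite inE => /andP[/fintype.subsetP XB _]; apply/setP => i; rewrite !inE.
    have [iX|iX] := boolP (i \in X); last by rewrite orbF andNb.
    move: (XB i iX); rewrite finset.in_setI => /andP[_ /(above_notin cS)->].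
    by rewrite orbT.
  by move=> X X' /sub EX /sub EX' E; rewrite EX EX' E.
apply: eq_card => Q; rewrite !inE; apply/idP/imsetP.
  case/andP => /and3P[QB /eqP cQ coneQ] /andP[SQ QS]; exists (Q :\: S).
    rewrite inE finset.subsetI QS cardsD (finset.setIidPr SQ) cS cQ addKn eqxx.
    by rewrite (fintype.subset_trans (subsetDl _ _) QB).
  by rewrite -{1}(finset.setID Q S) (finset.setIidPr SQ).
case=> X; rewrite inE finset.subsetI => /andP[/andP[XB XA] /eqP cX] ->.
have SX : [disjoint S & X].
  rewrite disjoint_sym disjoint_subset; apply/fintype.subsetP => i
    /(fintype.subsetP XA).
  exact: above_notin.
rewrite finset.subUset SB XB cardsU disjoint_setI0 // cards0 subn0 cS cX eqxx.
rewrite (cone_sub _ coneS) ?finset.subsetUl //=.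
by rewrite finset.setDUl finset.setDv finset.set0U (fintype.subset_trans _ XA)
  ?subsetDl.
Qed.

(* Every face has exactly one minimal basis, so the binomial sums of the numbers
   of points above count the faces and do not depend on the lift. *)
Lemma sum_binomial_above z B j : generic_lift z ->
  (\sum_(S in bases B) 'C(#|B :&: above z S|, j) = #|faces B j|)%N.
Proof.
move=> zgen.
under eq_bigr => S SB do rewrite -(card_min_extensions _ _ SB) -sum1_card.
pose r S Q := (S \subset Q) && (Q :\: S \subset above z S).
rewrite (eq_bigr (fun S => \sum_(Q in faces B j | r S Q) 1)%N); last first.
  by move=> S _; apply: eq_bigl => Q; rewrite inE.
rewrite (exchange_big_dep (mem (faces B j))) /=; last by move=> S Q _ /andP[].
rewrite -sum1_card; apply: eq_bigr => Q Qf.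
have := Qf; rewrite inE => /and3P[QB /eqP cQ coneQ].
have [|S SQ QS] := exists_min_basis zgen _ coneQ; first by rewrite cQ addSn ltnS
  leq_addr.
rewrite (big_pred1 S) // => S'; rewrite QB cQ eqxx coneQ /=.
apply/andP/eqP => [[S'B /andP[S'Q QS']]|->].
  apply: (min_basis_unique zgen _ SQ QS' QS).
  by move: S'B; rewrite !inE S'Q => /andP[].
move: SQ; rewrite /r QS !inE => /and3P[SQ -> ->].
by rewrite SQ (fintype.subset_trans SQ QB).
Qed.

(** The number above a basis is [#|B| - m.+1] minus the number below, and its distribution is fixed
    by binomial sums that count faces. *)
Lemma card_bases_below_invariant z z' B k : generic_lift z -> generic_lift z' ->
  #|bases_below z B k| = #|bases_below z' B k|.
Proof.
move=> zgen z'gen.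
have E z1 : generic_lift z1 -> bases_below z1 B k =
    (* For larger [k] the truncated subtraction would give [0] and wrongly select the bases with
       nothing above. *)
    if (k + m.+1 <= #|B|)%N then
      [set S in bases B | #|B :&: above z1 S| == (#|B| - m.+1 - k)%N] else finset.set0.
  move=> z1gen; apply/setP => S; rewrite inE.
  case: (boolP (S \in bases B)) => SB /=; last first.
    by case: ifP => _; rewrite inE // (negPf SB).
  have := card_below_above z1gen SB; case: ifP => kB; rewrite inE ?SB /=; lia.
rewrite !E //; case: ifP => // _; apply: count_from_binomials => j.
by rewrite !sum_binomial_above.
Qed.

(** * Raising one vector, and McMullen's recurrence *)

Lemma exists_high_lift z i : generic_lift z ->
  exists z', [/\ generic_lift z', forall q, q != i -> z' q = z q &
    forall S, #|S| = m.+1 -> i \notin S -> dot (interp z S) (v i) < z' i].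
Proof.
move=> [z0 zgen].
(* For [i] in [S], raising [i] to height [M] adds [(M - z i) * bary_coord S i (v j)] to the
   interpolant at [v j], so [bad S j] is the only height of [i] at which [j] becomes degenerate. [M]
   exceeds all of these. *)
pose bad S j := z i + (z j - dot (interp z S) (v j)) / bary_coord S i (v j).
pose M := 1 + (\sum_S `|dot (interp z S) (v i)| + \sum_S \sum_j `|bad S j|).
have s1 : 0 <= \sum_(S : {set T}) `|dot (interp z S) (v i)| by apply: sumr_ge0.
have s2 : 0 <= \sum_(S : {set T}) \sum_j `|bad S j|.
  by apply: sumr_ge0 => S _; apply: sumr_ge0.
have M1 S : dot (interp z S) (v i) < M.
  apply: (le_lt_trans (ler_norm _)).
  have : `|dot (interp z S) (v i)| <= \sum_(S : {set T}) `|dot (interp z S) (v i)|.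
    by rewrite (bigD1 S) //= lerDl; apply: sumr_ge0.
  by rewrite /M; lra.
have M2 S j : bad S j < M.
  apply: (le_lt_trans (ler_norm _)).
  have : `|bad S j| <= \sum_(S : {set T}) \sum_j `|bad S j|.
    rewrite (bigD1 S) //= (bigD1 j) //= -addrA lerDl addr_ge0 ?sumr_ge0 // => S' _.
    exact: sumr_ge0.
  by rewrite /M; lra.
pose z' q := if q == i then M else z q.
have z'i : z' i = M by rewrite /z' eqxx.
have z'n q : q != i -> z' q = z q by rewrite /z' => /negPf->.
exists z'; split=> [|//|S _ _]; last by rewrite z'i.
split=> [q|S j cS jS].
  rewrite /z'; case: ifP => // _; rewrite /M; lra.
have [iS|iS] := boolP (i \in S); last first.
  have -> : interp z' S = interp z S.
    apply/esym/interp_unique => // p pS; rewrite interpE // z'n //.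
    by apply: contraNneq iS => <-.
  have [->|ji] := eqVneq j i; first by rewrite z'i lt_eqF.
  by rewrite z'n // zgen.
have -> : interp z' S = interp z S + (M - z i) *: interp (fun q => (q == i)%:R) S.
  apply/esym/interp_unique => // p pS; rewrite dotDl dotZl !interpE //.
  rewrite /z'; case: eqP => [->|_]; first by rewrite mulr1 addrC subrK.
  by rewrite mulr0 addr0.
have ji : j != i by apply: contraNneq jS => ->.
rewrite z'n // dotDl dotZl -/(bary_coord S i (v j)).
apply/eqP => E; have := M2 S j; rewrite /bad -E [_ + _ - _]addrC addKr mulfK
  ?coord_v_neq0 //.
by rewrite addrC subrK ltxx.
Qed.

(** By invariance the right side may be counted with [i] raised. A basis that avoids [i] keeps its
    interpolant and has [i] above it, so adding [i] to [B :\ i] leaves its number below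
    unchanged. *)
Lemma card_bases_below_D1 z B i k : generic_lift z -> i \in B ->
  (#|bases_below z (B :\ i) k| <= #|bases_below z B k|)%N.
Proof.
move=> zgen iB; have [z' [z'gen z'n z'i]] := exists_high_lift i zgen.
rewrite (card_bases_below_invariant B k zgen z'gen); apply: subset_leq_card.
apply/fintype.subsetP => S; rewrite !inE.
case/andP => /and3P[SB /eqP cS ->] /eqP <-.
have iS : i \notin S.
  by apply/negP => /(fintype.subsetP SB); rewrite !inE eqxx.
rewrite (fintype.subset_trans SB (subD1set _ _)) cS eqxx /=; apply/eqP.
have E : interp z' S = interp z S.
  apply/esym/interp_unique => // p pS; rewrite interpE // z'n //.
  by apply: contraNneq iS => <-.
apply: eq_card => q; rewrite !inE E.
have [->|qi] := eqVneq q i; last by rewrite z'n.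
by rewrite iB /= ltNge ltW ?z'i.
Qed.

(* McMullen's double count of the pairs [(i, S)] with [i] outside the basis [S]. *)
Lemma sum_card_bases_below_D1 z B k : generic_lift z ->
  (\sum_(i in B) #|bases_below z (B :\ i) k| + (m.+1 + k) * #|bases_below z B k| =
   k.+1 * #|bases_below z B k.+1| + #|B| * #|bases_below z B k|)%N.
Proof.
move=> zgen.
pose b S := #|B :&: below z S|.
have cE k' : #|bases_below z B k'| = (\sum_(S in bases B) (b S == k'))%N.
  rewrite -sum1_card big_mkcond [RHS]big_mkcond; apply: eq_bigr => S _ /=.
  by rewrite [in LHS]inE; case: (S \in bases B) => //=; case: eqP.
(* A basis of [B] counts for [B :\ i] if [i] is one of [k.+1] vectors below it, or if [i] is above
   it and [k] vectors are below; an [i] in [S] contributes nothing. *)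
have cD i : i \in B -> #|bases_below z (B :\ i) k| =
    (\sum_(S in bases B) ((i \in below z S) * (b S == k.+1) +
                          (i \in above z S) * (b S == k)))%N.
  move=> iB; rewrite -sum1_card big_mkcond [RHS]big_mkcond.
  apply: eq_bigr => S _ /=; rewrite [in LHS]inE.
  have [SB|SB] := boolP (S \in bases B); last first.
    case: ifP => // /andP[]; move: SB; rewrite !inE => SB /and3P[SBi cS coneS].
    by rewrite cS coneS (fintype.subset_trans SBi (subD1set _ _)) in SB.
  have := SB; rewrite inE => /and3P[sSB /eqP cS coneS].
  rewrite in_above // [S \in bases _]inE cS coneS eqxx subsetD1 sSB /= andbT.
  have -> : (B :\ i) :&: below z S = (B :&: below z S) :\ i.
    by apply/setP => q; rewrite !(finset.in_setI, finset.in_setD) andbA.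
  have := cardsD1 i (B :&: below z S); rewrite -/(b S) finset.in_setI iB /=.
  have [ib|ib] := boolP (i \in below z S).
    rewrite (below_notin cS ib) /= => ->; rewrite add1n eqSS mul1n mul0n addn0.
    by case: eqP.
  by rewrite add0n => <-; case: (i \in S) => /=; rewrite ?mul1n ?mul0n.
rewrite (eq_bigr _ cD) exchange_big /= !cE !big_distrr /= -!big_split /=.
apply: eq_bigr => S SB; rewrite big_split /= -!big_distrl /=.
have cI (X : {set T}) : (\sum_(i in B) (i \in X) = #|B :&: X|)%N.
  rewrite -sum1_card big_mkcond [RHS]big_mkcond; apply: eq_bigr => i _.
  by rewrite inE; case: (i \in B); case: (i \in X).
rewrite !cI -/(b S) -(card_below_above zgen SB) -/(b S).
case: (b S =P k.+1) => E; case: (b S =P k) => E'; rewrite ?muln1 ?muln0; lia.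
Qed.

Lemma card_bases_below_succ z B k : generic_lift z ->
  (k.+1 * #|bases_below z B k.+1| <= (m.+1 + k) * #|bases_below z B k|)%N.
Proof.
move=> zgen; have := sum_card_bases_below_D1 B k zgen.
have : (\sum_(i in B) #|bases_below z (B :\ i) k| <= #|B| * #|bases_below z B k|)%N.
  by rewrite -sum_nat_const; apply: leq_sum => i iB; apply: card_bases_below_D1.
lia.
Qed.

(** A basis with nothing below it is a minimal basis of [B], and that is unique. *)
Lemma card_bases_below0 z B : generic_lift z -> (#|bases_below z B 0| <= 1)%N.
Proof.
move=> zgen; have H S : S \in bases_below z B 0 ->
    S \in bases B /\ B :\: S \subset above z S.
  rewrite inE cards_eq0 => /andP[SB /eqP b0]; split=> //.
  have := SB; rewrite inE => /and3P[sSB /eqP cS _].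
  apply/fintype.subsetP => i; rewrite inE => /andP[iS iB]; rewrite in_above // iS.
  by apply/negP => ib; move/setP/(_ i): b0; rewrite !finset.in_setI iB ib
    finset.in_set0.
apply/card_le1_eqP => S S' /H[SB bS] /H[S'B bS'].
exact: (min_basis_unique zgen S'B SB bS' bS).
Qed.

(** * The binomial bound and the case of equality *)

Lemma binS_ratio k : (k.+1 * 'C(m + k.+1, k.+1) = (m.+1 + k) * 'C(m + k, k))%N.
Proof. by rewrite addnS -mul_bin_diag addSn. Qed.

Lemma card_bases_below_le z B k : generic_lift z ->
  (#|bases_below z B k| <= 'C(m + k, k))%N.
Proof.
move=> zgen; elim: k => [|k IHk]; first by rewrite bin0 card_bases_below0.
(* The binomials satisfy with equality the inequality that [card_bases_below_succ] gives for the
   counts. *)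
rewrite -(leq_pmul2l (ltn0Sn k)) binS_ratio.
by apply: (leq_trans (card_bases_below_succ B k zgen)); rewrite leq_mul2l IHk orbT.
Qed.

(** A smaller [B] could be enlarged to [m] vectors. Some nonzero form kills these, hence also [y],
    against [y_gen]. *)
Lemma cone_card_gt B : (m <= #|T|)%N -> cone B -> (m < #|B|)%N.
Proof.
move=> cT /asboolP[w [_ yE]]; rewrite ltnNge; apply/negP => cB.
have [S BS cS] : exists2 S : {set T}, B \subset S & #|S| = m.
  have : (0 < #|[set A : {set T} | A \subset ~: B & #|A| == (m - #|B|)%N]|)%N.
    by rewrite cards_draws bin_gt0; have := cardsC B; lia.
  case/card_gt0P => A; rewrite inE => /andP[AB /eqP cA]; exists (B :|: A).
    exact: finset.subsetUl.
  rewrite cardsU (_ : B :&: A = finset.set0) ?cards0; first by rewrite cA; lia.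
  by apply/eqP; rewrite setI_eq0 disjoint_sym finset.disjoints_subset.
have [u u0 uS] : exists2 u : 'rV[R]_m.+1, u != 0 &
    forall p, p \in S -> dot u (v p) = 0.
  pose M := \matrix_(i < #|S|) v (enum_val i).
  have : \rank (kermx M^T) != 0%N.
    rewrite mxrank_ker mxrank_tr -lt0n subn_gt0 ltnS.
    by apply: leq_trans (rank_leq_row _) _; rewrite cS.
  rewrite mxrank_eq0 => /rowV0Pn[u /sub_kermxP uM u0]; exists u => // p pS.
  have := congr1 (fun A : 'rV_#|S| => A 0 (enum_rank_in pS p)) uM.
  rewrite !mxE => <-; apply: eq_bigr => j _.
  by rewrite !mxE enum_rankK_in.
case/negP: u0; apply/eqP; apply: (y_gen cS uS).
rewrite yE dot_sumr big1 // => p /(fintype.subsetP BS) pS.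
by rewrite dotZr uS ?mulr0.
Qed.

Lemma bases_below0_cone z B : generic_lift z -> (m <= #|T|)%N ->
  (#|bases_below z B 0| = 1)%N <-> cone B.
Proof.
move=> zgen cT; split=> [c1|coneB].
  have /card_gt0P[S] : (0 < #|bases_below z B 0|)%N by rewrite c1.
  by rewrite 2!inE => /andP[/and3P[SB _ coneS] _]; apply: (cone_sub SB).
apply/eqP; rewrite eqn_leq card_bases_below0 //=.
have [S SB abv] := exists_min_basis zgen (cone_card_gt cT coneB) coneB.
apply/card_gt0P; exists S; rewrite inE SB cards_eq0 /=; apply/eqP/setP => i.
have := SB; rewrite inE => /and3P[sSB /eqP cS _].
rewrite finset.in_setI finset.in_set0; apply/negP => /andP[iB ib].
have /(fintype.subsetP abv) : i \in B :\: S by rewrite inE iB (below_notin cS ib).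
by rewrite in_above // ib andbF.
Qed.

(** Induction on [k] through the recurrence. Maximality for [k.+1] forces maximality for [k] on [B]
    and on every [B :\ i]; conversely, these determine the count for [k.+1]. *)
Lemma card_bases_below_eq z B k : generic_lift z -> (m <= #|T|)%N ->
  (#|bases_below z B k| = 'C(m + k, k))%N <->
  (forall X : {set T}, X \subset B -> (#|X| <= k)%N -> cone (B :\: X)).
Proof.
move=> zgen cT; elim: k B => [|k IHk] B.
  rewrite bin0; apply: (iff_trans (bases_below0_cone B zgen cT)).
  split=> [coneB X _|]; last by move/(_ finset.set0); rewrite finset.setD0 cards0
    finset.sub0set; apply.
  by rewrite leqn0 cards_eq0 => /eqP->; rewrite finset.setD0.
have rec := sum_card_bases_below_D1 B k zgen.
have ratio := binS_ratio k.
split=> [max X XB cX|coneB].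
  have leD i : i \in B -> (#|bases_below z (B :\ i) k| <= #|bases_below z B k|)%N.
    exact: card_bases_below_D1.
  have hk : #|bases_below z B k| = 'C(m + k, k).
    apply/eqP; rewrite eqn_leq card_bases_below_le //=.
    rewrite -(@leq_pmul2l (m.+1 + k)) // -ratio -max.
    exact: card_bases_below_succ.
  have [X0|[i iX]] := set_0Vmem X.
    by apply: ((IHk B).1 hk) => //; rewrite X0 cards0.
  have iB : i \in B := fintype.subsetP XB i iX.
  (* By the recurrence the counts for all [B :\ j] sum to [#|B|] times the count for [B]; none
     exceeds that count, so all are equal to it. *)
  have hki : #|bases_below z (B :\ i) k| = 'C(m + k, k).
    apply/eqP; rewrite -hk eqn_leq leD //=.
    have : (\sum_(j in B :\ i) #|bases_below z (B :\ j) k| <=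
            \sum_(j in B :\ i) #|bases_below z B k|)%N.
      by apply: leq_sum => j; rewrite inE => /andP[_ /leD].
    move: rec; rewrite (big_setD1 i) //= max ratio -hk.
    rewrite sum_nat_const (cardsD1 i B) iB add1n mulSn.
    rewrite [LHS]addnC => /addnI E le.
    by rewrite -(leq_add2r (#|B :\ i| * #|bases_below z B k|)) -E leq_add2l.
  have -> : B :\: X = (B :\ i) :\: (X :\ i).
    apply/setP => q; rewrite !inE; have [->|_] /= := eqVneq q i; last by [].
    by rewrite iX.
  apply: ((IHk _).1 hki); first exact: finset.setSD.
  by move: (cardsD1 i X); rewrite iX; lia.
have hk : #|bases_below z B k| = 'C(m + k, k).
  by apply/IHk => X XB cX; apply: coneB => //; exact: leqW.
apply/eqP; rewrite -(eqn_pmul2l (ltn0Sn k)) ratio; apply/eqP.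
move: rec; rewrite (eq_bigr (fun=> 'C(m + k, k))); last first.
  move=> i iB; apply/IHk => X XB cX.
  rewrite finset.setDDl; apply: coneB; last by rewrite cardsU1; lia.
  rewrite finset.subUset finset.sub1set iB.
  exact: (fintype.subset_trans XB (subD1set _ _)).
rewrite sum_nat_const hk; lia.
Qed.

End Cone.

(** * Transfer between sets over the finite type [A] and finite sets of points *)

Section FsetOfSet.
Variables (K : choiceType) (A : {fset K}).
Implicit Types S : {set A}.

Definition fset_of_set S : {fset K} := [fset \val p | p in S]%fset.

Lemma mem_fset_of_set S (p : A) : (\val p \in fset_of_set S) = (p \in S).
Proof. by rewrite in_fsetE. Qed.

Lemma fset_of_setP S q : reflect (exists2 p : A, p \in S & q = \val p) (q \in
  fset_of_set S).
Proof. exact: imfsetP. Qed.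

Lemma fset_of_set_inj : injective fset_of_set.
Proof. by move=> S S' E; apply/setP => p; rewrite -!mem_fset_of_set E. Qed.

Lemma fset_of_set_sub S : (fset_of_set S `<=` A)%fset.
Proof. by apply/fsubsetP => q /fset_of_setP[p _ ->]; exact: valP. Qed.

Lemma fset_of_set_fsub (B : {fset K}) : (B `<=` A)%fset ->
  fset_of_set [set p : A | \val p \in B] = B.
Proof.
move=> /fsubsetP BA; apply/fsetP => q; apply/fset_of_setP/idP => [[p]|qB].
  by rewrite finset.in_set => ? ->.
by exists [` BA q qB]%fset; rewrite ?finset.in_set.
Qed.

Lemma card_fset_of_set S : #|` fset_of_set S|%fset = #|S|.
Proof. by rewrite card_imfset //= ?cardE //; exact: val_inj. Qed.

Lemma sum_fset_of_set (V : nmodType) S (F : K -> V) :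
  \sum_(q <- fset_of_set S) F q = \sum_(p in S) F (\val p).
Proof.
rewrite big_imfset /=; last by move=> p q _ _ /val_inj.
by rewrite big_enum.
Qed.

Definition extend (R : nmodType) (w : A -> R) (q : K) : R := oapp w 0 (insub q).

Lemma extendE (R : nmodType) (w : A -> R) p : extend w (\val p) = w p.
Proof. by rewrite /extend valK. Qed.
End FsetOfSet.

(** * Sphere equations and the interior of a Euclidean ball *)

Section Euclid.
Variables (R : realType) (d : nat).
Implicit Types (p q x u c : 'rV[R]_d) (b r s : R) (S : {fset 'rV[R]_d}).

Lemma dotBxx p c : dot (p - c) (p - c) = dot p p - 2 * dot c p + dot c c.
Proof. by rewrite dotDl !dotDr !dotNl !dotNr (dotC p c); ring. Qed.

Lemma enorm_ge0 p : 0 <= enorm p. Proof. exact: sqrtr_ge0. Qed.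

Lemma enorm_sqr p : enorm p ^+ 2 = dot p p.
Proof. by rewrite sqr_sqrtr // dotxx_ge0. Qed.

Lemma enormZ b p : enorm (b *: p) = `|b| * enorm p.
Proof. by rewrite /enorm dotZl dotZr mulrA -expr2 sqrtrM ?sqr_ge0 // sqrtr_sqr. Qed.

Lemma sphereE c r p : 0 < r -> sphere c r p <-> dot p p = r ^+ 2 - dot c c + 2 *
  dot c p.
Proof.
move=> r0; rewrite /sphere /=; split=> [E|E].
  by move: (enorm_sqr (p - c)); rewrite E dotBxx => ->; ring.
apply: (pexpIrn (n := 2)); rewrite ?nnegrE ?enorm_ge0 ?ltW //.
by rewrite enorm_sqr dotBxx E; ring.
Qed.

Lemma enorm_ltE c r p : 0 < r ->
  (enorm (p - c) < r) = (dot p p < r ^+ 2 - dot c c + 2 * dot c p).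
Proof.
move=> r0; rewrite -(@ltr_pXn2r _ 2) ?nnegrE ?enorm_ge0 ?ltW // enorm_sqr dotBxx.
by apply/idP/idP; lra.
Qed.

(** The equation says that all points of [S] have squared distance [s + dot c c] from [c]; this is
    positive since otherwise [S] would consist of [c] alone. *)
Lemma exists_circumsphere S c s : (1 < #|` S|%fset)%N ->
  (forall p, p \in S -> dot p p = s + 2 * dot c p) ->
  exists2 r, circumsphere S c r & r ^+ 2 = s + dot c c.
Proof.
move=> cS E; have D p : p \in S -> dot (p - c) (p - c) = s + dot c c.
  by move=> pS; rewrite dotBxx E //; ring.
have [p pS] : exists p, p \in S by apply/fset0Pn; rewrite -cardfs_gt0 ltnW.
have r0 : 0 < s + dot c c.
  rewrite lt_neqAle -{2}(D p pS) dotxx_ge0 andbT; apply/eqP => s0.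
  suff : (S `<=` [fset c])%fset by move/fsubset_leq_card; rewrite cardfs1; lia.
  apply/fsubsetP => q qS; rewrite in_fset1 -subr_eq0 -dotxx_eq0 D // -s0 //.
have r2 : Num.sqrt (s + dot c c) ^+ 2 = s + dot c c by rewrite sqr_sqrtr // ltW.
exists (Num.sqrt (s + dot c c)) => //; split=> [|q qS]; first by rewrite sqrtr_gt0.
by apply/sphereE; rewrite ?sqrtr_gt0 // r2 E //; ring.
Qed.

Lemma interior_cball c r p : 0 < r -> interior (cball c r) p <-> enorm (p - c) < r.
Proof.
move=> r0; split.
  rewrite /interior => /nbhs_ballP[e /= e0 eP].
  rewrite ltNge; apply/negP => rp.
  (* A point with [r <= enorm (p - c)] leaves the closed ball when pushed away from [c] by
     [t *: (p - c)]; [M] bounds the sup norm of [p - c], so the pushed point stays in the sup-norm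
     ball of radius [e]. *)
  pose M := 1 + \sum_i `|(p - c) ord0 i|.
  have M0 : 0 < M by rewrite ltr_pwDl // sumr_ge0.
  pose t := e / 2 / M.
  have t0 : 0 < t by rewrite !divr_gt0.
  have /eP : ball p e (p + t *: (p - c)).
    split=> // i j; rewrite /ball /= !mxE opprD addNKr normrN normrM gtr0_norm //.
    apply: (@le_lt_trans _ _ (t * M)); last first.
      by rewrite /t divfK ?gt_eqF // ltr_pdivrMr //; lra.
    rewrite ler_pM2l // /M (bigD1 j) //= !ord1 !mxE addrCA lerDl.
    by rewrite addr_ge0 // sumr_ge0.
  rewrite /cball /= -addrA addrC -addrA.
  have -> : t *: (p - c) + (- c + p) = (1 + t) *: (p - c).
    by rewrite scalerDl scale1r addrC [- c + p]addrC.
  rewrite enormZ gtr0_norm ?addr_gt0 // leNgt => /negP; apply.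
  apply: (le_lt_trans rp); rewrite ltr_pMl ?ltrDl //.
  exact: lt_le_trans rp.
move=> pr; rewrite /interior.
have p2 : dot (p - c) (p - c) < r ^+ 2.
  by rewrite -enorm_sqr ltr_pXn2r ?nnegrE ?enorm_ge0 ?ltW.
(* Changing a coordinate [X] of [p - c] by less than [e <= 1] raises its square by at most
   [(2 * |X| + 1) * e]. *)
pose M := 1 + \sum_i (2 * `|(p - c) ord0 i| + 1).
have M1 : 1 <= M by rewrite lerDl sumr_ge0 // => i _; rewrite addr_ge0 // mulr_ge0.
have M0 : 0 < M by apply: lt_le_trans M1.
pose e := Num.min 1 ((r ^+ 2 - dot (p - c) (p - c)) / M).
have e0 : 0 < e by rewrite lt_min ltr01 divr_gt0 // subr_gt0.
have e1 : e <= 1 by rewrite ge_min lexx.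
have eM : e * M <= r ^+ 2 - dot (p - c) (p - c).
  by rewrite -ler_pdivlMr // ge_min lexx orbT.
apply/nbhs_ballP; exists e => //= q pq.
rewrite /cball /= -(@ler_pXn2r _ 2) ?nnegrE ?enorm_ge0 ?(ltW r0) // enorm_sqr.
have qi i : `|p ord0 i - q ord0 i| < e by have := pq.2 ord0 i.
suff : dot (q - c) (q - c) <= dot (p - c) (p - c) + e * M by lra.
rewrite /M mulrDr mulr1 mulr_sumr addrCA /dot.
rewrite -big_split /=; apply: ler_wpDl; first exact: ltW.
apply: ler_sum => i _; rewrite !mxE.
have := qi i; set P := p ord0 i; set Q := q ord0 i; set C := c ord0 i => PQ.
have -> : Q - C = (P - C) - (P - Q) by ring.
set X := P - C; set Y := P - Q in PQ *.
have Y2 : Y * Y <= e.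
  rewrite -expr2 -real_normK ?num_real // expr2.
  by apply: (le_trans (ler_piMl _ _)); rewrite ?normr_ge0 // ?(le_trans (ltW PQ))
    // ltW.
have XY : - (X * Y) <= `|X| * e.
  apply: (le_trans (ler_norm _)); rewrite normrN normrM.
  by rewrite ler_wpM2l // ltW.
by nra.
Qed.
End Euclid.

(** * Homogeneous coordinates: from affine to linear statements *)

Section Homogenization.
Variables (R : realType) (d : nat).
Implicit Types (p q x u c : 'rV[R]_d) (b r s : R) (A S : {fset 'rV[R]_d}).

Definition homog b p : 'rV[R]_d.+1 := row_mx (b%:M : 'M_1) p.

Lemma dot_homog a b p q : dot (homog a p) (homog b q) = a * b + dot p q.
Proof. exact: dot_row_mx. Qed.

Lemma homogP (u : 'rV[R]_d.+1) : exists b p, u = homog b p.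
Proof.
exists ((lsubmx (u : 'rV_(1 + d))) 0 0), (rsubmx (u : 'rV_(1 + d))).
by rewrite /homog -mx11_scalar hsubmxK.
Qed.

Lemma homog_inj a b p q : homog a p = homog b q -> a = b /\ p = q.
Proof.
by move=> /(@eq_row_mx R 1 1 d _ _ _ _)[/matrixP/(_ 0 0)]; rewrite !mxE eqxx !mulr1n.
Qed.

Lemma homog00 : homog 0 0 = 0.
Proof. by rewrite /homog raddf0 row_mx0. Qed.

Lemma homogZ a b p : a *: homog b p = homog (a * b) (a *: p).
Proof. by rewrite /homog -scale_scalar_mx; exact: (@scale_row_mx R 1 1 d a b%:M p). Qed.

Lemma homogD a b p q : homog a p + homog b q = homog (a + b) (p + q).
Proof. by rewrite /homog raddfD; exact: (@add_row_mx R 1 1 d a%:M p b%:M q). Qed.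

Lemma sum_homog (I : finType) (P : pred I) (w : I -> R) (f : I -> 'rV[R]_d) :
  \sum_(i | P i) w i *: homog 1 (f i) =
  homog (\sum_(i | P i) w i) (\sum_(i | P i) w i *: f i).
Proof.
elim/big_rec3: _ => [|i a b c _ ->]; first by rewrite homog00.
by rewrite homogZ homogD mulr1.
Qed.

(** The extra coordinate carries the condition that the weights sum to [1]. *)
Lemma cone_conv A x (S : {set A}) :
  cone (fun p : A => homog 1 (\val p)) (homog 1 x) S <-> conv (fset_of_set S) x.
Proof.
split.
  case/asboolP => w [w0]; rewrite sum_homog => /homog_inj[w1 xE].
  exists (extend w); split=> [q /fset_of_setP[p pS ->]||].
  - by rewrite extendE w0.
  - by rewrite sum_fset_of_set w1; apply: eq_bigr => p _; rewrite extendE.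
  - by rewrite sum_fset_of_set xE; apply: eq_bigr => p _; rewrite extendE.
case=> w [w0 w1 xE]; apply/asboolP; exists (fun p : A => w (\val p)); split=> [p pS|].
  by rewrite w0 // mem_fset_of_set.
by rewrite sum_homog xE -w1 !sum_fset_of_set.
Qed.

Lemma not_hyperplane_homog S b u : (0 < #|` S|%fset)%N -> ~ on_common_hyperplane S ->
  (forall p, p \in S -> dot (homog b u) (homog 1 p) = 0) -> homog b u = 0.
Proof.
rewrite cardfs_gt0 => /fset0Pn[p pS] nhyp E.
have u0 : u = 0.
  apply: contrapT => /eqP u0; apply: nhyp; exists u, (- b); split=> // q /E.
  by rewrite dot_homog mulr1 => /eqP; rewrite addrC addr_eq0 => /eqP.
have := E p pS; rewrite u0 dot_homog dot0l mulr1 addr0 => ->.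
exact: homog00.
Qed.

(** * The paraboloid lift: hefty simplices as bases, the hull as a cone condition *)

Section Lift.
Variables (A : {fset 'rV[R]_d}) (x : 'rV[R]_d).
Hypothesis (d_gt0 : (0 < d)%N) (x_gen : generic_wrt A x).

Let v (p : A) := homog 1 (\val p).
Let y := homog 1 x.
(** The [+ 1] makes the height positive even at the origin; it only shifts the constant terms of the
    interpolants. *)
Let z (p : A) : R := dot (\val p) (\val p) + 1.

Lemma homog_gen (S : {set A}) : #|S| = d.+1 ->
  forall u : 'rV[R]_d.+1, (forall p : A, p \in S -> dot u (v p) = 0) -> u = 0.
Proof.
move=> cS u; have [b [q ->]] := homogP u => E.
apply: (@not_hyperplane_homog (fset_of_set S)).
- by rewrite card_fset_of_set cS.
- apply: (x_gen.2.1); last by rewrite card_fset_of_set.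
  exact: (fsubset_trans (fset_of_set_sub S) (fsubsetU1 _ _)).
- by move=> _ /fset_of_setP[p pS ->]; apply: E.
Qed.

Lemma homog_gen_point (S : {set A}) : #|S| = d ->
  forall u : 'rV[R]_d.+1, (forall p : A, p \in S -> dot u (v p) = 0) -> dot u y = 0
    -> u = 0.
Proof.
move=> cS u; have [b [q ->]] := homogP u => E Ey.
have cx : #|` (x |` fset_of_set S)%fset| = d.+1.
  rewrite cardfsU1 card_fset_of_set cS; case: fset_of_setP => [[p _ xE]|//].
  by case: x_gen; rewrite xE (valP p).
apply: (@not_hyperplane_homog (x |` fset_of_set S)%fset).
- by rewrite cx.
- apply: (x_gen.2.1) => //; apply: fsetUS; exact: fset_of_set_sub.
- move=> p; rewrite in_fset1U => /orP[/eqP->//|/fset_of_setP[p' pS ->]].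
  exact: E.
Qed.

(** The form [homog b u] encodes the sphere with centre [c = u / 2] and
    [r ^+ 2 - dot c c = b - 1]. *)
Lemma dot_lift b u (p : A) : (dot (homog b u) (v p) == z p) =
  (dot (\val p) (\val p) == (b - 1) + 2 * dot (2^-1 *: u) (\val p)).
Proof.
rewrite dot_homog dotZl /z mulr1 mulrA divff ?mul1r ?pnatr_eq0 //.
by apply/eqP/eqP; lra.
Qed.

Lemma lt_dot_lift b u (p : A) : (z p < dot (homog b u) (v p)) =
  (dot (\val p) (\val p) < (b - 1) + 2 * dot (2^-1 *: u) (\val p)).
Proof.
rewrite dot_homog dotZl /z mulr1 mulrA divff ?mul1r ?pnatr_eq0 //.
by apply/idP/idP; lra.
Qed.

(** A lifted point on the interpolant of [d.+1] others would give [d.+2] points on a sphere. *)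
Lemma paraboloid_generic_lift : generic_lift v z.
Proof.
split=> [p|S i cS iS]; first by rewrite /z ltr_wpDl ?dotxx_ge0.
apply/eqP => Ei; have [b [u uE]] := homogP (interp v z S).
have c2 : #|i |: S| = d.+2 by rewrite cardsU1 iS cS.
have [||r rP _] := @exists_circumsphere _ _ (fset_of_set (i |: S)) (2^-1 *: u) (b - 1).
- by rewrite card_fset_of_set c2.
- move=> _ /fset_of_setP[p pS ->]; apply/eqP; rewrite -dot_lift -uE; apply/eqP.
  move: pS; rewrite !finset.in_setU1 => /orP[/eqP->//|pS].
  exact: (interpE homog_gen).
case: (x_gen.2.2 (fset_of_set (i |: S))).
- exact: (fsubset_trans (fset_of_set_sub _) (fsubsetU1 _ _)).
- by rewrite card_fset_of_set.
- by exists (2^-1 *: u), r.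
Qed.

Lemma card_points_inside (B : {set A}) c r : 0 < r -> #|B| = d.+1 ->
  circumsphere (fset_of_set B) c r ->
  #|` points_inside A c r|%fset = #|[set: A] :&: below v z B|.
Proof.
move=> r0 cB [_ cr].
have uE : homog (r ^+ 2 - dot c c + 1) (2 *: c) = interp v z B.
  apply: (interp_unique homog_gen) => // p pB; apply/eqP; rewrite dot_lift.
  rewrite scalerA mulVf ?pnatr_eq0 // scale1r addrK; apply/eqP/sphereE => //.
  by apply: cr; rewrite mem_fset_of_set.
rewrite -card_fset_of_set; congr (#|` _|%fset); apply/fsetP => q.
rewrite /points_inside !in_fset inE /=; apply/andP/fset_of_setP.
  case=> qA /asboolP; rewrite interior_cball // enorm_ltE // => lt.
  exists [` qA]%fset => //; rewrite finset.in_setI finset.in_setT /= finset.in_set.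
  by rewrite -uE lt_dot_lift scalerA mulVf ?pnatr_eq0 // scale1r addrK.
case=> p; rewrite finset.in_setI finset.in_setT /= finset.in_set -uE lt_dot_lift.
rewrite scalerA mulVf ?pnatr_eq0 // scale1r addrK => lt ->; split; first exact: valP.
by apply/asboolP; rewrite interior_cball // enorm_ltE.
Qed.

Lemma bases_below_hefty k (S : {set A}) :
  (S \in bases_below v y z [set: A] k) =
  `[< hefty A k (fset_of_set S) /\ conv (fset_of_set S) x >].
Proof.
rewrite finset.in_set [S \in bases _ _ _]finset.in_set finset.subsetT /=.
apply/andP/asboolP => [[/andP[/eqP cS coneS] /eqP bk]|[[[_ cS _] [c [r [cr ck]]]] cx]].
  split; last exact/cone_conv.
  have [b [u uE]] := homogP (interp v z S).
  have [||r rP r2] := @exists_circumsphere _ _ (fset_of_set S) (2^-1 *: u) (b - 1).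
  - by rewrite card_fset_of_set cS ltnS.
  - move=> _ /fset_of_setP[p pS ->]; apply/eqP; rewrite -dot_lift -uE; apply/eqP.
    exact: (interpE homog_gen).
  split; last first.
    exists (2^-1 *: u), r; split=> //.
    by rewrite (card_points_inside _ cS rP) //; case: rP.
  split; [exact: fset_of_set_sub | by rewrite card_fset_of_set |].
  move=> w; rewrite !sum_fset_of_set => w0 wp0 q /fset_of_setP[p pS ->].
  (* An affine dependence is a vanishing combination of homogenized points, and its weights are the
     coordinates of [0]. *)
  have <- := coord_comb homog_gen (fun p : A => w (\val p)) cS pS.
  by rewrite sum_homog w0 wp0 homog00 /bary_coord dotC dot0l.
move: cS; rewrite card_fset_of_set => cS; rewrite cS eqxx /=; split.
  exact/cone_conv.
by rewrite -(card_points_inside _ cS cr) ?ck //; case: cr.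
Qed.

Lemma card_hefty_bases k : #|` hefty_simplices_containing A k x|%fset =
  #|bases_below v y z [set: A] k|.
Proof.
transitivity #|` [fset fset_of_set S | S in bases_below v y z [set: A] k]%fset|%fset.
  congr (#|` _|%fset); apply/fsetP => S; rewrite /hefty_simplices_containing
    in_fset inE /=.
  rewrite fpowersetE; apply/andP/imfsetP => [[SA hS]|[S' /= S'b ->]].
    exists [set p : A | \val p \in S]; last by rewrite fset_of_set_fsub.
    by rewrite /= bases_below_hefty fset_of_set_fsub.
  by rewrite fset_of_set_sub -bases_below_hefty.
by rewrite card_imfset /= ?cardE //; exact: fset_of_set_inj.
Qed.

(** If [X] is what a half-space misses, the half-space contains the convex hull of the other points.
    If [x] is not in the hull of the points outside [X], the form from [farkas] bounds a half-space
    that misses only points of [X] and excludes [x]. *)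
Lemma hull_cone k : hull A k x <->
  forall X : {set A}, X \subset [set: A] -> (#|X| <= k)%N -> cone v y ([set: A] :\: X).
Proof.
split=> [hx X _ cX|hx H [[u [b [u0 ->]]] cH]]; last first.
  pose X := [set p : A | b < dot u (\val p)].
  have cX : (#|X| <= k)%N.
    apply: leq_trans cH; rewrite -card_fset_of_set; apply: fsubset_leq_card.
    apply/fsubsetP => _ /fset_of_setP[p pX ->]; rewrite in_fset inE /= (valP p) /=.
    apply/negP; rewrite inE /= leNgt; move: pX; rewrite finset.in_set => ->.
    by [].
  have /asboolP[w [w0]] := hx X (finset.subsetT _) cX.
  rewrite sum_homog => /homog_inj[w1 xE].
  rewrite /= xE dot_sumr -[b]mul1r w1 mulr_suml; apply: ler_sum => p pX.
  rewrite dotZr ler_wpM2l ?w0 // leNgt.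
  by move: pX; rewrite finset.in_setD finset.in_set => /andP[].
case: (farkas ([set: A] :\: X) v y) => [?|[U [U0 Uy]]]; first exact/asboolP.
have [b [u uE]] := homogP U.
suff [u' [b' [u'0 u'X xb]]] : exists u' b', [/\ u' != 0,
    forall p : A, p \in [set: A] :\: X -> dot u' (\val p) <= b' & b' < dot u' x].
  suff : dot u' x <= b' by rewrite leNgt xb.
  apply: (hx [set q | dot u' q <= b']%classic); split; first by exists u', b'.
  apply: leq_trans cX; rewrite -card_fset_of_set; apply: fsubset_leq_card.
  apply/fsubsetP => q; rewrite in_fset inE /= => /andP[qA].
  move=> /negP qH; apply/fset_of_setP; exists [` qA]%fset => //.
  apply: contraT => qX; case: qH; rewrite inE /=.
  by apply: (u'X [` qA]%fset); rewrite finset.in_setD qX finset.in_setT.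
(* A constant form can separate only if no point is left outside [X]; then any half-space that
   excludes [x] will do. *)
have [uz|u0] := eqVneq u 0.
  pose u1 : 'rV[R]_d := const_mx 1.
  exists u1, (dot u1 x - 1); split=> [|p pX|]; last by rewrite gtrBl.
    apply/eqP => /rowP/(_ (Ordinal d_gt0)); rewrite !mxE => /eqP.
    by rewrite oner_eq0.
  have := lt_le_trans Uy (le_trans (_ : _ <= dot U (v p)) (U0 p pX)).
  by rewrite uE !dot_homog uz !dot0l ltxx => /(_ (lexx _)).
exists u, (- b); split=> // [p /U0|].
  by rewrite uE dot_homog; lra.
by move: Uy; rewrite uE dot_homog; lra.
Qed.

Lemma card_hefty_le k :
  (#|` hefty_simplices_containing A k x|%fset <= 'C(d + k, k))%N.
Proof.
rewrite card_hefty_bases; apply: (card_bases_below_le homog_gen homog_gen_point).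
exact: paraboloid_generic_lift.
Qed.

Lemma card_hefty_eq k : (d <= #|` A|%fset)%N ->
  #|` hefty_simplices_containing A k x|%fset = 'C(d + k, k) <-> hull A k x.
Proof.
move=> dA; rewrite card_hefty_bases; apply: (iff_trans _ (iff_sym (hull_cone k))).
apply: (card_bases_below_eq homog_gen homog_gen_point).
  exact: paraboloid_generic_lift.
by rewrite -cardfE.
Qed.
End Lift.
End Homogenization.

(** * Simplices with the vertex [a], seen from [a] *)

Section Link.
Variables (R : realType) (d : nat) (A : {fset 'rV[R]_d.+1}) (a x : 'rV[R]_d.+1).
Hypotheses (aA : a \in A) (x_gen : generic_wrt A x).

Let B := (A `\ a)%fset.
Let v (p : B) := \val p - a.
Let y := x - a.
(** A sphere through [a] with centre [c] reads [dot q q = 2 * dot (c - a) q] in [q = p - a]. There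
    is no constant term, hence no homogenizing coordinate, and this lowers the dimension by one. *)
Let z (p : B) : R := dot (\val p - a) (\val p - a).

Lemma link_sub (S : {set B}) : (a |` fset_of_set S `<=` x |` A)%fset.
Proof.
apply/fsubsetP => q; rewrite in_fset1U => /orP[/eqP->|/fset_of_setP[p _ ->]].
  by rewrite in_fset1U aA orbT.
by have := valP p; rewrite in_fsetD1 in_fset1U => /andP[_ ->]; rewrite orbT.
Qed.

Lemma card_link (S : {set B}) : #|` (a |` fset_of_set S)%fset| = #|S|.+1.
Proof.
rewrite cardfsU1 card_fset_of_set; case: fset_of_setP => [[p _ aE]|//].
by have := valP p; rewrite in_fsetD1 -aE eqxx.
Qed.

Lemma link_gen (S : {set B}) : #|S| = d.+1 ->
  forall u, (forall p, p \in S -> dot u (v p) = 0) -> u = 0.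
Proof.
move=> cS u E; apply: contrapT => /eqP u0.
case: (x_gen.2.1 (a |` fset_of_set S)%fset).
- exact: link_sub.
- by rewrite card_link cS.
- exists u, (dot u a); split=> // q.
  rewrite in_fset1U => /orP[/eqP->//|/fset_of_setP[p /E]].
  by rewrite /v dotDr dotNr => /eqP; rewrite subr_eq0 => /eqP <- ->.
Qed.

Lemma link_gen_point (S : {set B}) : #|S| = d ->
  forall u, (forall p, p \in S -> dot u (v p) = 0) -> dot u y = 0 -> u = 0.
Proof.
move=> cS u E Ey; apply: contrapT => /eqP u0.
case: (x_gen.2.1 (x |` (a |` fset_of_set S))%fset).
- by rewrite fsubUset fsub1set fset1U1 link_sub.
- rewrite cardfsU1 card_link cS in_fset1U; case: eqP => [xa|_] /=.
    by case: x_gen; rewrite xa aA.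
  case: fset_of_setP => [[p _ xE]|//].
  by case: x_gen; have := valP p; rewrite in_fsetD1 -xE => /andP[_ ->].
- exists u, (dot u a); split=> // q.
  rewrite !in_fset1U => /or3P[/eqP->|/eqP->//|/fset_of_setP[p /E]].
    by move/eqP: Ey; rewrite dotDr dotNr subr_eq0 => /eqP.
  by rewrite /v dotDr dotNr => /eqP; rewrite subr_eq0 => /eqP <- ->.
Qed.

Lemma link_generic_lift : generic_lift v z.
Proof.
split=> [p|S i cS iS].
  by rewrite dotxx_gt0 subr_eq0; have := valP p; rewrite in_fsetD1 => /andP[].
apply/eqP; set u := interp v z S => Ei.
have [||r rP _] := @exists_circumsphere _ _ (a |` fset_of_set (i |: S))%fset
    (a + 2^-1 *: u) (- dot u a - dot a a).
- by rewrite card_link ltnS cardsU1 iS.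
- move=> q; rewrite in_fset1U !dotDl dotZl => /orP[/eqP->|/fset_of_setP[p pS ->]].
    by lra.
  have : dot u (v p) = z p.
    move: pS; rewrite finset.in_setU1 => /orP[/eqP->//|pS].
    exact: (interpE link_gen).
  by rewrite /z dotBxx /v dotDr dotNr; lra.
case: (x_gen.2.2 (a |` fset_of_set (i |: S))%fset).
- exact: link_sub.
- by rewrite card_link cardsU1 iS cS.
- by exists (a + 2^-1 *: u), r.
Qed.

(** A simplex with vertex [a] lies in the cone that its other vertices span from [a]. Only this
    inclusion is used, so the simplices inject into the bases and an upper bound follows. *)
Lemma hefty_link k S : S \in hefty_simplices_containing A k x -> a \in S ->
  exists2 X : {set B}, X \in bases_below v y z [set: B] k &
    S = (a |` fset_of_set X)%fset.
Proof.
rewrite /hefty_simplices_containing in_fset inE /= => /andP[_ /asboolP[]].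
move=> [[SA cS _] [c [r [[r0 cr] ck]]]] [w [w0 w1 xE]] aS.
pose X := [set p : B | \val p \in (S `\ a)%fset].
have XS : fset_of_set X = (S `\ a)%fset by rewrite fset_of_set_fsub // fsetSD.
exists X; last by rewrite XS fsetD1K.
have cX : #|X| = d.+1.
  by rewrite -card_fset_of_set XS; move: cS; rewrite (cardfsD1 a) aS; lia.
have coneX : cone v y X.
  apply/asboolP; exists (fun p : B => w (\val p)); split=> [p|].
    by rewrite finset.in_set in_fsetD1 => /andP[_ /w0].
  rewrite -(@sum_fset_of_set _ _ _ X (fun q => w q *: (q - a))) XS.
  transitivity (\sum_(q <- S) w q *: (q - a)).
    under eq_bigr do rewrite scalerBr.
    by rewrite sumrB -scaler_suml w1 scale1r -xE.
  by rewrite (big_fsetD1 a) //= subrr scaler0 add0r.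
have aE : dot a a = r ^+ 2 - dot c c + 2 * dot c a by apply/sphereE => //; exact: cr.
have E q : dot (2 *: (c - a)) (q - a) - dot (q - a) (q - a) =
    r ^+ 2 - dot c c + 2 * dot c q - dot q q.
  rewrite dotBxx dotZl !dotDl !dotNl !dotDr !dotNr; move: aE; lra.
have uE : 2 *: (c - a) = interp v z X.
  apply: (interp_unique link_gen) => // p.
  rewrite finset.in_set in_fsetD1 => /andP[_ /cr/sphereE pE].
  by have := E (\val p); rewrite pE // subrr => /eqP; rewrite subr_eq0 => /eqP.
have lt q : (dot (q - a) (q - a) < dot (interp v z X) (q - a)) =
    (dot q q < r ^+ 2 - dot c c + 2 * dot c q).
  by rewrite -subr_gt0 -uE E subr_gt0.
rewrite finset.in_set finset.in_set finset.subsetT cX eqxx coneX /= -ck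
  -card_fset_of_set.
apply/eqP; congr (#|` _|%fset); apply/fsetP => q.
rewrite /points_inside in_fset inE /=; apply/fset_of_setP/andP.
  case=> p; rewrite finset.in_setI finset.in_setT /= finset.in_set lt => pq ->.
  have := valP p; rewrite in_fsetD1 => /andP[_ pA]; split=> //.
  by apply/asboolP; rewrite interior_cball // enorm_ltE.
case=> qA /asboolP; rewrite interior_cball // enorm_ltE // => qin.
(* The vertex [a] lies on the sphere, so it is not among the points inside. *)
have qB : q \in B.
  rewrite in_fsetD1 qA andbT; apply: contraTneq qin => ->.
  by rewrite -aE ltxx.
exists [` qB]%fset => //.
by rewrite finset.in_setI finset.in_setT /= finset.in_set lt.
Qed.

Lemma card_hefty_link_le k :
  (#|` [fset S in hefty_simplices_containing A k x | a \in S]%fset|%fset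
     <= 'C(d + k, k))%N.
Proof.
apply: (@leq_trans #|bases_below v y z [set: B] k|); last first.
  exact: (card_bases_below_le link_gen link_gen_point _ _ link_generic_lift).
apply: (@leq_trans #|` [fset a |` fset_of_set X
    | X in bases_below v y z [set: B] k]%fset|%fset); last first.
  by rewrite (leq_trans (leq_imfset_card _ _ _)) //= cardE.
apply: fsubset_leq_card; apply/fsubsetP => S.
rewrite in_fset inE /= => /andP[Sh aS].
by have [X Xb ->] := hefty_link Sh aS; apply/imfsetP; exists X.
Qed.
End Link.

Local Open Scope fset_scope.

(* The guard d <= #|` A| excludes sets A with fewer than d points, for which
   the equality criterion fails: genericity is then vacuous, there are no
   simplices, and x may still lie in the hull (d = 3, k = 0, A a pair of points
   and x their midpoint). *)
Theorem theorem4 (R : realType) (d : nat) (hd : (1 <= d)%N)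
    (A : {fset 'rV[R]_d}) (hA : generic A) (k : nat)
    (a : 'rV[R]_d) (ha : a \in A) :
  (forall x : 'rV[R]_d, generic_wrt A x ->
     (#|` hefty_simplices_containing A k x| <= 'C(d + k, d))%N /\
     ((d <= #|` A|)%N ->
      (#|` hefty_simplices_containing A k x| = 'C(d + k, d) <-> hull A k x))) /\
  (exists eps : R, 0 < eps /\
     forall x : 'rV[R]_d, generic_wrt A x -> enorm (x - a) < eps ->
       (#|` [fset S in hefty_simplices_containing A k x | a \in S]|
          <= 'C(d + k - 1, d - 1))%N).
Proof.
have binE n : 'C(n + k, n) = 'C(n + k, k) by rewrite -bin_sub ?leq_addr // addKn.
split=> [x x_gen|].
  by rewrite binE; split; [exact: card_hefty_le | exact: card_hefty_eq].
(* A simplex with vertex [a] that contains [x] also contains the points of the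
   segment [a, x] close to [a], so the bound holds for all [x]. *)
exists 1; split=> // x x_gen _.
case: d hd A hA a ha x x_gen => // d _ A _ a aA x x_gen.
by rewrite addSn !subSS !subn0 binE; exact: card_hefty_link_le.
Qed.
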